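(* Let $d\in\mathbb{C}$ with $d\ne0,-1,-2,\dots$, and let $n\in\mathbb{N}_0$. Then $$\sum_{k=0}^{\lfloor n/2\rfloor}\frac{1}{2^{2k}}\binom{n}{2k}\binom{2k}{k}\frac{\binom{k+d}{k}}{\binom{k+d-1}{k}}=\left[\frac{n(n-1)}{4d}+n-\frac12\right]\frac{2^n\,\Gamma\!\left(n-\frac12\right)}{\sqrt{\pi}\,\Gamma(n+1)}.$$
   Context: $\mathbb{N}_0=\{0,1,2,\dots\}$; $\lfloor\cdot\rfloor$ is the floor function; $\Gamma$ is Euler's gamma function, defined on $\mathbb{C}\setminus\{0,-1,-2,\dots\}$. The Pochhammer symbol is $(\alpha)_0=1$, $(\alpha)_m=\alpha(\alpha+1)\cdots(\alpha+m-1)$ for $m\ge1$. Binomial coefficients with non-integer upper entry are generalized binomial coefficients; explicitly, for $k\in\mathbb{N}_0$, $\binom{k+d}{k}=\frac{(d+1)_k}{k!}$ and $\binom{k+d-1}{k}=\frac{(d)_k}{k!}$. *)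

(* Defs.v *)
From HB Require Import structures.
From mathcomp Require Import all_boot all_order all_algebra.
From mathcomp Require Import complex.
From mathcomp Require Import all_classical all_reals all_analysis.

Set Implicit Arguments.
Unset Strict Implicit.
Unset Printing Implicit Defensive.

Import Order.TTheory GRing.Theory Num.Theory.
Import numFieldNormedType.Exports.

Local Open Scope ring_scope.
Local Open Scope classical_set_scope.
Local Open Scope complex_scope.

Definition pochhammer (K : fieldType) (a : K) (m : nat) : K :=
  \prod_(i < m) (a + i%:R).

(* a (a - 1) ... (a - k + 1) / k! for an arbitrary upper entry a. *)
Definition gbinom (K : fieldType) (a : K) (k : nat) : K :=
  (\prod_(i < k) (a - i%:R)) / k`!%:R.

Lemma gbinom_pochhammer (K : fieldType) (d : K) (k : nat) :
  gbinom (k%:R + d) k = pochhammer (d + 1) k / k`!%:R.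
Proof.
rewrite /gbinom /pochhammer; congr (_ / _).
rewrite (reindex_inj rev_ord_inj); apply: eq_bigr => i _ /=.
by rewrite natrB // -addn1 natrD opprB [k%:R + d]addrC -addrA subrKC addrAC addrA.
Qed.

Lemma gbinom_pochhammerB1 (K : fieldType) (d : K) (k : nat) :
  gbinom (k%:R + d - 1) k = pochhammer d k / k`!%:R.
Proof. by rewrite -addrA gbinom_pochhammer subrK. Qed.

Definition cexp (R : realType) (z : R[i]) : R[i] :=
  (expR (complex.Re z))%:C * (cos (complex.Im z) +i* sin (complex.Im z)).

(* Principal power x ^ z of a positive real base. *)
Definition cpow (R : realType) (x : R) (z : R[i]) : R[i] :=
  cexp (z * (ln x)%:C).

(* Euler's product formula  lim_m  m! m^z / (z (z + 1) ... (z + m)),  which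
   converges on the whole domain C \ {0, -1, -2, ...} of the gamma function
   (in particular at z = -1/2, where the integral of t^(z - 1) e^(-t)
   diverges).  Its value at the poles is a junk value.
   R[i] carries its norm topology through the regular module (R[i])^o. *)
Definition Gamma (R : realType) (z : R[i]) : R[i] :=
  lim ((fun m : nat =>
    (m`!%:R * cpow (m%:R : R) z / pochhammer z m.+1 : (R[i])^o)) @ \oo).

(* Main.v *)
Require Import Defs.
From mathcomp Require Import all_boot all_order all_algebra.
From mathcomp Require Import complex.
From mathcomp Require Import all_classical all_reals all_analysis.
From mathcomp Require Import zify ring lra.

Import Order.TTheory GRing.Theory Num.Theory numFieldNormedType.Exports.

Local Open Scope ring_scope.
Local Open Scope complex_scope.

(** Since [(d + 1)_k / (d)_k = (d + k) / d = 1 + k / d], the sum is affine in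
    [1 / d], with coefficients the plain and the [k]-weighted sums of
    [N_k = C(n, 2k) C(2k, k) 2^(n - 2k)], divided by [2^n].  Both come from
    coefficients of [(1 + X)^(2m) = ((1 + 2X) + X^2)^m] ([bin_double]):
    - [N_k = C(n, k) C(n - k, n - 2k) 2^(n - 2k)] is the [k]-th contribution to
      the coefficient of [X^n] for [m = n], whence [sum N_k = C(2n, n)];
    - absorbing [k] by [k C(n, k) = n C(n - 1, k - 1)] yields the coefficient of
      [X^(n - 2)] for [m = n - 1], whence [sum k N_k = n C(2n - 2, n - 2)].

    The right-hand side needs [Gamma (n + 1) = n!] and
    [(n - 1/2) Gamma (n - 1/2) = (1/2)_n sqrt pi], where
    [(1/2)_n = n! C(2n, n) / 4^n].  Every argument being real, the computation
    takes place on the real sequence of Euler's product, whose limit is carried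
    along [x |-> x + 1] in both directions ([euler_seqD1]) and then to the
    complex numbers ([Gamma_real]).  The starting values are [Gamma 1 = 1],
    which is immediate, and [Gamma (1/2) = sqrt pi], which is Wallis's product.

    Wallis's product comes from the inequalities between the consecutive
    integrals of [sin^n] over [0, pi / 2].  Integration itself is avoided: the
    reduction formula defines a primitive of [sin^n] outright, and comparing two
    primitives only requires the sign of a derivative. *)

(** * Binomial sums *)

Lemma coef_linear_exp (K : comNzSemiRingType) (c : K) (N a : nat) :
  ((1 + c *: 'X) ^+ N)`_a = c ^+ a *+ 'C(N, a).
Proof.
rewrite exprDn coef_sum.
under eq_bigr => i _ do rewrite expr1n mul1r exprZn coefMn coefZ coefXn.
have [leaN|ltNa] := leqP a N; last first.
  rewrite bin_small // mulr0n big1 // => i _.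
  by rewrite gtn_eqF ?mulr0 ?mul0rn // (leq_ltn_trans _ ltNa) // -ltnS ltn_ord.
have lta : (a < N.+1)%N by [].
rewrite (bigD1 (Ordinal lta)) //= eqxx mulr1 big1 ?addr0 // => i.
by rewrite -val_eqE /= eq_sym => /negPf ->; rewrite mulr0 mul0rn.
Qed.

(** Coefficient of [X^a] in [(1 + X)^(2m) = ((1 + 2X) + X^2)^m]: the index [k]
    counts the factors contributing [X^2]. *)
Lemma bin_double (m a : nat) :
  ('C(m.*2, a)
   = \sum_(0 <= k < a./2.+1)
       'C(m, k) * 'C(m - k, a - k.*2) * 2 ^ (a - k.*2))%N.
Proof.
(* The guard replaces truncated subtraction: without it the terms with
   a < 2k would count as coefficients of degree 0. *)
pose t k := ((k.*2 <= a) * ('C(m, k) * 'C(m - k, a - k.*2) * 2 ^ (a - k.*2)))%N.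
transitivity (\sum_(0 <= k < m.+1) t k)%N.
  have sq : (1 + 1 *: 'X : {poly nat}) ^+ m.*2 = ((1 + 2 *: 'X) + 'X^2) ^+ m.
    rewrite -mul2n exprM; congr (_ ^+ m); rewrite scale1r -mul_polyC; ring.
  have := congr1 (fun p : {poly nat} => p`_a) sq.
  rewrite /= coef_linear_exp expr1n natn => ->.
  rewrite exprDn coef_sum big_mkord; apply: eq_bigr => k _.
  rewrite coefMn -exprM mul2n coefMXn coef_linear_exp /t ltnNge.
  case: leqP => /= _; rewrite ?mul0n ?mul0rn // mul1n.
  rewrite -[LHS]mulr_natr -[X in X * _ = _]mulr_natr !natn [LHS]mulrC.
  by rewrite [X in _ * X = _]mulrC [LHS]mulrA natrXE.
(* Terms vanish for k > m and for k > a / 2, so both ranges agree with a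
   common larger one. *)
have extend N M : (N <= M)%N -> (forall k, (N <= k)%N -> t k = 0%N) ->
    (\sum_(0 <= k < N) t k = \sum_(0 <= k < M) t k)%N.
  move=> leNM t0; rewrite (big_cat_nat (leq0n N) leNM) /= -[LHS]addn0.
  congr (_ + _)%N.
  by rewrite big_nat big1 // => i /andP[/t0->].
rewrite (extend m.+1 (m.+1 + a./2.+1)%N) ?leq_addr //; last first.
  by move=> k ltmk; rewrite /t bin_small ?mul0n ?muln0.
rewrite -(extend a./2.+1) ?leq_addl //; last first.
  by move=> k ltak; rewrite /t leqNgt; have -> : (a < k.*2)%N by lia.
apply: eq_big_nat => k ltka; have le2ka : (k.*2 <= a)%N by lia.
by rewrite /t le2ka mul1n.
Qed.

(** Both sides are the multinomial coefficient [n! / (k! k! (n - 2k)!)]. *)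
Lemma bin_trinomial (n k : nat) : (k.*2 <= n)%N ->
  ('C(n, k) * 'C(n - k, n - k.*2) = 'C(n, k.*2) * 'C(k.*2, k))%N.
Proof.
move=> le2kn; have lekn : (k <= n)%N by lia.
have le2 : (n - k.*2 <= n - k)%N by lia.
have le3 : (k <= k.*2)%N by lia.
have f1 := bin_fact lekn; have f2 := bin_fact le2.
have f3 := bin_fact le2kn; have f4 := bin_fact le3.
have e1 : (n - k - (n - k.*2) = k)%N by lia.
have e2 : (k.*2 - k = k)%N by lia.
rewrite e1 in f2; rewrite e2 in f4.
have p0 : (0 < k`! * k`! * (n - k.*2)`!)%N by rewrite !muln_gt0 !fact_gt0.
apply/eqP; rewrite -(eqn_pmul2r p0); apply/eqP.
transitivity n`!; first by rewrite -f1 -f2; ring.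
by rewrite -f3 -f4; ring.
Qed.

Lemma central_sum (n : nat) :
  (\sum_(0 <= k < n./2.+1) 'C(n, k.*2) * 'C(k.*2, k) * 2 ^ (n - k.*2)
   = 'C(n.*2, n))%N.
Proof.
rewrite bin_double; apply: eq_big_nat => k ltk.
by rewrite bin_trinomial //; lia.
Qed.

(** The absorption [k C(n, k) = n C(n - 1, k - 1)] turns the weighted sum into
    an instance of [bin_double].  The boolean factor handles [n = 1], where
    [n.-2] truncates to 0. *)
Lemma weighted_central_sum (n : nat) :
  (\sum_(0 <= k < n./2.+1) k * ('C(n, k.*2) * 'C(k.*2, k) * 2 ^ (n - k.*2))
   = n * (1 < n) * 'C(n.-1.*2, n.-2))%N.
Proof.
case: n => [|[|n]]; rewrite ?big_nat1 //.
rewrite big_nat_recl //= mul0n add0n muln1 bin_double big_distrr /=.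
apply: eq_big_nat => k ltk.
rewrite -bin_trinomial; last by lia.
by rewrite !mulnA -mul_bin_diag doubleS !subSS.
Qed.

(** Ratio of the two binomials closing the sums above, at [n + 2]: it turns
    [C(2n - 2, n - 2)] into a rational multiple of [C(2n, n)]. *)
Lemma mul_bin_central (n : nat) :
  ((4 * n + 6) * 'C(n.+1.*2, n) = n.+1 * 'C(n.+2.*2, n.+2))%N.
Proof.
have f1 : (n <= n.+1.*2)%N by lia.
have f2 : (n.+2 <= n.+2.*2)%N by lia.
have e1 := bin_fact f1; have e2 := bin_fact f2.
have x1 : (n.+1.*2 - n = n.+2)%N by lia.
have x2 : (n.+2.*2 - n.+2 = n.+2)%N by lia.
rewrite x1 in e1; rewrite x2 in e2.
have p0 : (0 < n`! * n.+2`! * n.+2)%N by rewrite !muln_gt0 !fact_gt0.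
apply/eqP; rewrite -(eqn_pmul2r p0); apply/eqP.
transitivity (n.+2.*2`!)%N.
  transitivity ((4 * n + 6) * n.+2 * (n.+1.*2)`!)%N; first by rewrite -e1; ring.
  by rewrite (doubleS n.+1) !factS !mulnA; congr (_ * _)%N; lia.
by rewrite -e2 [in RHS]mulnA (factS n.+1) (factS n); ring.
Qed.

(** * Pochhammer symbols *)

Lemma pochhammerSr (K : fieldType) (a : K) (m : nat) :
  pochhammer a m.+1 = pochhammer a m * (a + m%:R).
Proof. by rewrite /pochhammer big_ord_recr. Qed.

Lemma pochhammerSl (K : fieldType) (a : K) (m : nat) :
  pochhammer a m.+1 = a * pochhammer (a + 1) m.
Proof.
rewrite /pochhammer big_ord_recl addr0; congr (_ * _).
by apply: eq_bigr => i _; rewrite -addrA lift0 -nat1r.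
Qed.

Lemma pochhammer1 (K : fieldType) (m : nat) : pochhammer (1 : K) m = m`!%:R.
Proof.
elim: m => [|m IH]; first by rewrite /pochhammer big_ord0.
by rewrite pochhammerSr IH factS natrM mulrC nat1r.
Qed.

Lemma pochhammer_gt0 (K : numFieldType) (a : K) (m : nat) :
  0 < a -> 0 < pochhammer a m.
Proof. by move=> a0; apply: prodr_gt0 => i _; rewrite ltr_wpDr. Qed.

Lemma rmorph_pochhammer (K L : fieldType) (f : {rmorphism K -> L}) (a : K)
    (n : nat) :
  f (pochhammer a n) = pochhammer (f a) n.
Proof.
rewrite /pochhammer rmorph_prod.
by apply: eq_bigr => i _; rewrite rmorphD rmorph_nat.
Qed.

Lemma pochhammer_half (K : numFieldType) (n : nat) :
  4 ^+ n * pochhammer (1 / 2 : K) n = n`!%:R * 'C(n.*2, n)%:R.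
Proof.
elim: n => [|n IH]; first by rewrite /pochhammer big_ord0 bin0 fact0 expr0.
have step : (n.+1`! * 'C(n.+1.*2, n.+1) = (4 * n + 2) * (n`! * 'C(n.*2, n)))%N.
  have f1 : (n <= n.*2)%N by lia.
  have f2 : (n.+1 <= n.+1.*2)%N by lia.
  have e1 := bin_fact f1; have e2 := bin_fact f2.
  have x1 : (n.*2 - n = n)%N by lia.
  have x2 : (n.+1.*2 - n.+1 = n.+1)%N by lia.
  rewrite x1 in e1; rewrite x2 in e2.
  have p0 : (0 < n.+1`!)%N by rewrite fact_gt0.
  apply/eqP; rewrite -(eqn_pmul2r p0); apply/eqP.
  transitivity (n.+1.*2)`!; first by rewrite -e2; ring.
  transitivity ((4 * n + 2) * n.+1 * (n.*2)`!)%N; last first.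
    by rewrite -e1 factS; ring.
  by rewrite doubleS !factS mulnA; congr (_ * _)%N; lia.
rewrite -natrM step natrM natrM -IH pochhammerSr exprS natrD natrM.
by move: (pochhammer _ _) => p; field.
Qed.

(** The factorials cancel, and splitting [(d)_(k + 1)] at either end gives
    [d (d + 1)_k = (d)_k (d + k)]. *)
Lemma gbinom_ratio (K : numFieldType) (d : K) (k : nat) :
  (forall j : nat, d != - j%:R) ->
  gbinom (k%:R + d) k / gbinom (k%:R + d - 1) k = 1 + k%:R / d.
Proof.
move=> hd; rewrite gbinom_pochhammer gbinom_pochhammerB1.
have d0 : d != 0 by have := hd 0%N; rewrite oppr0.
have f0 : k`!%:R != 0 :> K by rewrite pnatr_eq0 -lt0n fact_gt0.
have p0 : pochhammer d k != 0.
  by apply/prodf_neq0 => i _; rewrite addr_eq0.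
have : d * pochhammer (d + 1) k = pochhammer d k * (d + k%:R).
  by rewrite -pochhammerSl pochhammerSr.
move: (pochhammer (d + 1) k) (pochhammer d k) p0 => q p p0 qE.
have -> : q = p * (d + k%:R) / d by rewrite -qE mulrC mulKf.
by field; rewrite d0 p0 f0.
Qed.

(** * Wallis's product *)

(** The primitive of [sin^n] vanishing at 0, given by the reduction formula
    [n I_n = (n - 1) I_(n - 2) - cos sin^(n - 1)] of integration by parts. *)
Fixpoint sin_power_primitive {R : realType} (n : nat) (x : R) : R :=
  match n with
  | 0 => x
  | 1 => 1 - cos x
  | m.+2 =>
      (m.+1%:R * sin_power_primitive m x - cos x * sin x ^+ m.+1) / m.+2%:R
  end.

(** Two consecutive indices are proved together because the recursion has step
    two. *)
Lemma is_derive_sin_power_primitive {R : realType} (n : nat) (x : R) :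
  is_derive x 1 (sin_power_primitive n) (sin x ^+ n)
  /\ is_derive x 1 (sin_power_primitive n.+1) (sin x ^+ n.+1).
Proof.
elim: n => [|n [IH0 IH1]].
  split; first by rewrite expr0; exact: is_derive_id.
  rewrite /=; apply: is_derive_eq; rewrite expr1; ring.
split=> //=.
have -> : (fun y : R =>
    (n.+1%:R * sin_power_primitive n y - cos y * sin y ^+ n.+1) / n.+2%:R)
  = n.+2%:R^-1 *: (n.+1%:R *: sin_power_primitive n - cos * sin ^+ n.+1).
  by apply/funext => y; rewrite !fctE /= mulrC.
apply: is_derive_eq.
rewrite exprfctE /GRing.scale /= !exprS.
have n2 : n%:R + 2 != 0 :> R by rewrite -natrD pnatr_eq0 addn2.
have := cos2Dsin2 x; rewrite -!natr1 => cs.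
have -> : cos x * (((n%:R + 1) * sin x ^+ n) * cos x)
  = (n%:R + 1) * sin x ^+ n * (1 - sin x ^+ 2) by rewrite -cs; ring.
by field.
Qed.

Lemma sin_power_primitive0 {R : realType} (n : nat) :
  sin_power_primitive n 0 = 0 :> R /\ sin_power_primitive n.+1 0 = 0 :> R.
Proof.
elim: n => [|n [IH0 IH1]]; first by rewrite /= cos0 subrr.
by split=> //=; rewrite IH0 sin0 expr0n /= !mulr0 subr0 mul0r.
Qed.

(** The Wallis integral of [sin^n] over [0, pi / 2]. *)
Definition wallis (R : realType) (n : nat) : R :=
  sin_power_primitive n (pi / 2).

Lemma wallisSS (R : realType) (n : nat) :
  wallis R n.+2 = n.+1%:R / n.+2%:R * wallis R n.
Proof. by rewrite /wallis /= cos_pihalf mul0r subr0 mulrAC. Qed.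

(** The difference of the primitives of [sin^n] and [sin^(n + 1)] vanishes at 0
    and has derivative [sin^n (1 - sin)], nonnegative on [0, pi / 2]. *)
Lemma wallis_le (R : realType) (n : nat) : wallis R n.+1 <= wallis R n.
Proof.
pose f : R -> R :=
  fun x => sin_power_primitive n x - sin_power_primitive n.+1 x.
have df (x : R) : is_derive x 1 f (sin x ^+ n - sin x ^+ n.+1).
  have [? ?] := is_derive_sin_power_primitive n x.
  exact: is_deriveB.
have : f 0 <= f (pi / 2).
  have pi0 : 0 <= pi / 2 :> R by rewrite divr_ge0 // pi_ge0.
  apply: (@ger0_derive1_ndecr _ f 0 (pi / 2)) => //.
  - move=> x xpi; have ? := df x.
    rewrite derive1E derive_val exprS -[X in X - _]mul1r -mulrBl.
    have s0 : 0 <= sin x.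
      apply: sin_ge0_pi; move: xpi; rewrite in_itv /= => /andP[? ?]; lra.
    by rewrite mulr_ge0 ?exprn_ge0 // subr_ge0 sin_le1.
  - apply: derivable_within_continuous => x _; have ? := df x; exact: ex_derive.
have [F0 F1] := @sin_power_primitive0 R n.
by rewrite /f F0 F1 subrr subr_ge0.
Qed.

Lemma wallis_even (R : realType) (m : nat) :
  wallis R m.*2 = pi / 2 * (pochhammer (1 / 2 : R) m / m`!%:R).
Proof.
elim: m => [|m IH].
  by rewrite /wallis /pochhammer /= big_ord0 fact0 divr1 mulr1.
rewrite doubleS wallisSS IH pochhammerSr factS natrM -mul2n -!natr1 natrM.
have := fact_gt0 m; rewrite -(ltr_nat R) => f0; have m0 : 0 <= m%:R :> R by [].
by field; rewrite !gt_eqF //; lra.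
Qed.

Lemma wallis_odd (R : realType) (m : nat) :
  wallis R m.*2.+1 = m`!%:R / (pochhammer (1 / 2 : R) m * m.*2.+1%:R).
Proof.
have h2 : 0 < 1 / 2 :> R by rewrite divr_gt0.
elim: m => [|m IH].
  rewrite /wallis /pochhammer /= big_ord0 fact0 cos_pihalf.
  by rewrite subr0 mul1r divr1.
have p0 := pochhammer_gt0 R (1 / 2) m h2.
rewrite doubleS wallisSS IH pochhammerSr.
move: (pochhammer _ _) p0 => p p0.
rewrite factS natrM -mul2n -!natr1 natrM.
have m0 : 0 <= m%:R :> R by [].
by field; rewrite !gt_eqF //; lra.
Qed.

(** * Euler's product on the real line *)

(** For real [x], the sequence whose limit defines [Gamma x]. *)
Definition euler_seq (R : realType) (x : R) (m : nat) : R :=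
  m`!%:R * expR (x * ln m%:R) / pochhammer x m.+1.

(** With [W_j] the Wallis integrals and [p = (1/2)_m / m!], the inequalities
    [W_(2m+2) <= W_(2m+1) <= W_(2m)] bound [p ^ 2] on both sides, and the square
    of the Euler sequence at 1/2 is [m / (p (m + 1/2)) ^ 2]. *)
Lemma euler_seq_half_bounds (R : realType) (m : nat) : (0 < m)%N ->
  pi * (m%:R / m.+1%:R) <= euler_seq R (1 / 2) m ^+ 2 <= pi.
Proof.
move=> m_gt0; have m0 : 0 < m%:R :> R by rewrite ltr0n.
have h2 : 0 < 1 / 2 :> R by rewrite divr_gt0.
have p0 := pochhammer_gt0 R (1 / 2) m h2.
have f0 : 0 < m`!%:R :> R by rewrite ltr0n fact_gt0.
have odd_le_even := wallis_le R m.*2.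
have even_le_odd := wallis_le R m.*2.+1.
rewrite wallis_even wallis_odd in odd_le_even.
rewrite wallisSS wallis_even wallis_odd in even_le_odd.
have pi0 := pi_gt0 R.
have -> : euler_seq R (1 / 2) m ^+ 2
  = m%:R / ((pochhammer (1 / 2 : R) m / m`!%:R) * (1 / 2 + m%:R)) ^+ 2.
  rewrite /euler_seq pochhammerSr.
  have sq : expR (1 / 2 * ln m%:R) ^+ 2 = m%:R :> R.
    by rewrite -expRM_natl -[RHS]lnK //; congr expR; field.
  move: (expR _) sq => u sq; rewrite -[X in _ = X / _]sq.
  by field; rewrite !gt_eqF //; lra.
have o1 : m.*2.+1%:R = 2 * m%:R + 1 :> R by rewrite -natr1 -mul2n natrM.
have o2 : m.*2.+2%:R = 2 * m%:R + 2 :> R by rewrite -addn2 natrD -mul2n natrM.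
set p := pochhammer (1 / 2 : R) m / m`!%:R in odd_le_even even_le_odd *.
have pp : 0 < p by rewrite divr_gt0.
have e : m`!%:R / (pochhammer (1 / 2 : R) m * m.*2.+1%:R)
  = (p * (2 * m%:R + 1))^-1 :> R.
  rewrite /p o1; move: (pochhammer _ _) p0 => q q0.
  by field; rewrite !gt_eqF //; lra.
have lower : 1 <= pi / 2 * p ^+ 2 * (2 * m%:R + 1).
  rewrite e -div1r ler_pdivrMr in odd_le_even; last by rewrite mulr_gt0 //; lra.
  apply: (le_trans odd_le_even).
  by rewrite le_eqVlt; apply/orP; left; apply/eqP; ring.
have upper : pi / 2 * p ^+ 2 * (2 * m%:R + 1) ^+ 2 <= 2 * m%:R + 2.
  rewrite e -[X in _ <= X]div1r ler_pdivlMr in even_le_odd; last first.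
    by rewrite mulr_gt0 //; lra.
  rewrite o1 o2 in even_le_odd.
  have -> : pi / 2 * p ^+ 2 * (2 * m%:R + 1) ^+ 2
    = (2 * m%:R + 2) * ((2 * m%:R + 1) / (2 * m%:R + 2) * (pi / 2 * p)
                        * (p * (2 * m%:R + 1))).
    by field; rewrite gt_eqF //; lra.
  by rewrite -[X in _ <= X]mulr1 ler_pM2l //; lra.
have D0 : 0 < (p * (1 / 2 + m%:R)) ^+ 2.
  by rewrite exprn_gt0 // mulr_gt0 //; lra.
rewrite ler_pdivrMr // ler_pdivlMr // -natr1; apply/andP; split.
  have -> : pi * (m%:R / (m%:R + 1)) * (p * (1 / 2 + m%:R)) ^+ 2
    = (m%:R / (2 * m%:R + 2)) * (pi / 2 * p ^+ 2 * (2 * m%:R + 1) ^+ 2).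
    by field; rewrite !gt_eqF //; lra.
  rewrite mulrAC ler_pdivrMr; last lra.
  by rewrite ler_pM2l.
have -> : pi * (p * (1 / 2 + m%:R)) ^+ 2
  = (pi / 2 * p ^+ 2 * (2 * m%:R + 1)) * (m%:R + 1 / 2) by field.
apply: (@le_trans _ _ (1 * (m%:R + 1 / 2))); first lra.
by rewrite ler_pM2r //; lra.
Qed.

Lemma cvg_nat_ratio (R : realType) (x : R) : - 1 < x ->
  (m%:R / (x + m.+1%:R) @[m --> \oo] --> (1 : R))%classic.
Proof.
move=> x1.
have h : ((1 - harmonic m) / (1 + x * harmonic m) @[m --> \oo]
          --> ((1 - 0) / (1 + x * 0) : R))%classic.
  have hc := @cvg_harmonic R.
  apply: cvgM; first by apply: cvgB => //; exact: cvg_cst.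
  apply: cvgV; first by rewrite mulr0 addr0 oner_eq0.
  by apply: cvgD; [exact: cvg_cst|apply: cvgMr].
rewrite mulr0 addr0 subr0 divr1 in h.
apply: cvg_trans h; apply: near_eq_cvg; near=> m.
rewrite /= -natr1; have m0 : 0 <= m%:R :> R by [].
by field; rewrite !gt_eqF //; lra.
Unshelve. all: by end_near.
Qed.

(** [Gamma (1/2) = sqrt pi]: squeeze the square, then take the root. *)
Lemma cvg_euler_seq_half (R : realType) :
  (euler_seq R (1 / 2) @ \oo --> (Num.sqrt pi : R))%classic.
Proof.
have h2 : 0 < 1 / 2 :> R by rewrite divr_gt0.
have sq : ((euler_seq R (1 / 2) m) ^+ 2 @[m --> \oo] --> (pi : R))%classic.
  apply: (@squeeze_cvgr _ _ _ _
    (fun m : nat => pi * (m%:R / (0 + m.+1%:R))) (fun=> pi)).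
  - near=> m; rewrite add0r; apply: euler_seq_half_bounds.
    near: m; exact: nbhs_infty_gt.
  - rewrite -[X in (_ --> X)%classic]mulr1.
    by apply: cvgMr; apply: cvg_nat_ratio; lra.
  - exact: cvg_cst.
have : (Num.sqrt (euler_seq R (1 / 2) m ^+ 2) @[m --> \oo]
        --> (Num.sqrt pi : R))%classic.
  by apply: continuous_cvg sq; exact: sqrt_continuous.
apply: cvg_trans; apply: near_eq_cvg; near=> m.
rewrite /= sqrtr_sqr ger0_norm // divr_ge0 ?ltW ?pochhammer_gt0 //.
by rewrite mulr_gt0 ?expR_gt0.
Unshelve. all: by end_near.
Qed.

Lemma euler_seq1 (R : realType) (m : nat) : (0 < m)%N ->
  euler_seq R 1 m = m%:R / (0 + m.+1%:R).
Proof.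
move=> m0; rewrite /euler_seq mul1r lnK ?posrE ?ltr0n // pochhammer1.
have f0 : m`!%:R != 0 :> R by rewrite pnatr_eq0 -lt0n fact_gt0.
by rewrite factS natrM add0r [m`!%:R * _]mulrC -mulf_div divff ?mulr1.
Qed.

(** The functional equation [Gamma (x + 1) = x Gamma x] holds for the Euler
    sequences up to a factor tending to 1. *)
Lemma euler_seqD1 (R : realType) (x : R) (m : nat) :
  -1 < x -> x != 0 -> (0 < m)%N ->
  euler_seq R (x + 1) m = x * euler_seq R x m * (m%:R / (x + m.+1%:R)).
Proof.
move=> x1 x0 m0; have p0 := pochhammer_gt0 R (x + 1) m.
rewrite /euler_seq mulrDl mul1r expRD lnK ?posrE ?ltr0n //.
rewrite (pochhammerSl _ x) pochhammerSr.
move: (pochhammer _ _) p0 => p p0.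
have {}p0 : 0 < p by apply: p0; lra.
have M0 : 0 <= m%:R :> R by [].
rewrite -addrA nat1r; field.
by rewrite x0 !gt_eqF // -?natr1; lra.
Qed.

Lemma cvg_euler_seqD1 (R : realType) (x l : R) : -1 < x -> x != 0 ->
  (euler_seq R x @ \oo --> l)%classic ->
  (euler_seq R (x + 1) @ \oo --> x * l)%classic.
Proof.
move=> x1 x0 cl.
have : (x * euler_seq R x m * (m%:R / (x + m.+1%:R)) @[m --> \oo]
        --> x * l * 1)%classic.
  by apply: cvgM; [apply: cvgMr|exact: cvg_nat_ratio].
rewrite mulr1; apply: cvg_trans; apply: near_eq_cvg; near=> m.
apply/esym/euler_seqD1 => //; near: m; exact: nbhs_infty_gt.
Unshelve. all: by end_near.
Qed.

(** The backward direction of the functional equation reaches [x = -1/2], which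
    is outside the range [x > 0] of [cvg_euler_seq_shift]. *)
Lemma cvg_euler_seqB1 (R : realType) (x l : R) : -1 < x -> x != 0 ->
  (euler_seq R (x + 1) @ \oo --> l)%classic ->
  (euler_seq R x @ \oo --> l / x)%classic.
Proof.
move=> x1 x0 cl.
have : (euler_seq R (x + 1) m / (m%:R / (x + m.+1%:R)) / x @[m --> \oo]
        --> l / 1 / x)%classic.
  apply: cvgMl; apply: cvgM => //; apply: cvgV; first by rewrite oner_eq0.
  exact: cvg_nat_ratio.
rewrite divr1; apply: cvg_trans; apply: near_eq_cvg; near=> m.
have m_gt0 : (0 < m)%N by near: m; exact: nbhs_infty_gt.
have M0 : 0 < m%:R :> R by rewrite ltr0n.
rewrite euler_seqD1 //; field.
by rewrite x0 !gt_eqF // -?natr1; lra.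
Unshelve. all: by end_near.
Qed.

Lemma cvg_euler_seq_shift (R : realType) (x l : R) (n : nat) : 0 < x ->
  (euler_seq R x @ \oo --> l)%classic ->
  (euler_seq R (x + n%:R) @ \oo --> pochhammer x n * l)%classic.
Proof.
move=> x0 cl; elim: n => [|n IH].
  by rewrite addr0 /pochhammer big_ord0 mul1r.
have xn : 0 < x + n%:R by rewrite ltr_wpDr.
rewrite pochhammerSr -natr1 addrA [_ * (x + _)]mulrC -mulrA.
apply: cvg_euler_seqD1 => //; [lra | by rewrite gt_eqF].
Qed.

(** * Values of the complex gamma function *)

Lemma complex_norm_real (R : realType) (x : R) : `|x%:C| = `|x|%:C.
Proof. by rewrite normc_def /= expr0n addr0 sqrtr_sqr. Qed.

(** The radii of the balls of [R[i]] are positive elements of [R[i]], hence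
    real. *)
Lemma cvg_real_complex (R : realType) (u : nat -> R) (l : R) :
  (u @ \oo --> l)%classic ->
  ((fun m => (u m)%:C : R[i]^o) @ \oo --> (l%:C : R[i]^o))%classic.
Proof.
move=> ul; apply/cvgrPdist_lt => e e0.
have [er ei] : 0 < complex.Re e /\ e = (complex.Re e)%:C.
  move: e0; rewrite ltcE /= => /andP[/eqP i0 r0].
  by split=> //; case: e i0 r0 => a b /= ->.
move/cvgrPdist_lt: ul => /(_ _ er).
apply: filterS => m; rewrite {2}ei -rmorphB.
by rewrite complex_norm_real ltcR.
Qed.

Lemma Gamma_real (R : realType) (x l : R) :
  (euler_seq R x @ \oo --> l)%classic -> Gamma x%:C = l%:C.
Proof.
move=> cl; apply: (cvg_lim (@norm_hausdorff _ R[i]^o)).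
apply: cvg_trans (cvg_real_complex _ _ _ cl); apply: near_eq_cvg; near=> m.
rewrite /euler_seq !rmorphM fmorphV rmorph_nat; congr (_ * _ / _).
  by rewrite /cpow /cexp -rmorphM /= cos0 sin0 complexr0 mulr1.
exact: rmorph_pochhammer.
Unshelve. all: by end_near.
Qed.

Lemma half_real_complex (R : realType) : 1 / 2 = (1 / 2)%:C :> R[i].
Proof. by rewrite fmorph_div rmorph1 rmorph_nat. Qed.

(** Shifting up from 1/2 gives [Gamma (n + 1/2)], and one backward step gives
    [Gamma (n - 1/2)] uniformly in [n], the negative argument for [n = 0]
    included. *)
Lemma Gamma_sub_half (R : realType) (n : nat) :
  Gamma (n%:R - 1 / 2 : R[i])
  = pochhammer (1 / 2) n * (Num.sqrt pi)%:C / (n%:R - 1 / 2).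
Proof.
have N0 : 0 <= n%:R :> R by [].
have shiftE : n%:R - 1 / 2 = (n%:R - 1 / 2)%:C :> R[i].
  by rewrite rmorphB rmorph_nat half_real_complex.
rewrite shiftE half_real_complex -rmorph_pochhammer -rmorphM -fmorph_div.
apply: Gamma_real; apply: cvg_euler_seqB1; first lra.
  have [->|n0] := eqVneq n 0%N; first by rewrite lt_eqF //; lra.
  have n1 : 1 <= n%:R :> R by rewrite ler1n lt0n.
  by rewrite gt_eqF //; lra.
have -> : n%:R - 1 / 2 + 1 = 1 / 2 + n%:R :> R by field.
by apply: cvg_euler_seq_shift; [lra|exact: cvg_euler_seq_half].
Qed.

Lemma Gamma_nat (R : realType) (n : nat) : Gamma (n%:R + 1 : R[i]) = n`!%:R.
Proof.
have -> : n%:R + 1 = (1 + n%:R)%:C :> R[i].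
  by rewrite rmorphD rmorph_nat rmorph1 addrC.
rewrite -[RHS](rmorph_nat (real_complex R)).
have -> : n`!%:R = pochhammer 1 n * 1 :> R by rewrite pochhammer1 mulr1.
apply: Gamma_real; apply: cvg_euler_seq_shift => //.
have := cvg_nat_ratio R 0; rewrite ltrN10 => /(_ isT).
apply: cvg_trans; apply: near_eq_cvg; near=> m.
apply/esym/euler_seq1; near: m; exact: nbhs_infty_gt.
Unshelve. all: by end_near.
Qed.

(** * The identity *)

Theorem theorem4p3 (R : realType) (d : R[i]) (hd : forall j : nat, d != - j%:R)
    (n : nat) :
  \sum_(0 <= k < (n./2).+1)
     1 / 2 ^+ (2 * k) * 'C(n, 2 * k)%:R * 'C(2 * k, k)%:R
       * (gbinom (k%:R + d) k / gbinom (k%:R + d - 1) k)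
  = (n%:R * (n%:R - 1) / (4 * d) + n%:R - 1 / 2)
    * (2 ^+ n * Gamma (n%:R - 1 / 2)
       / ((Num.sqrt (pi : R))%:C * Gamma (n%:R + 1))).
Proof.
have d0 : d != 0 by have := hd 0%N; rewrite oppr0.
have t0 j : 2 ^+ j != 0 :> R[i] by rewrite expf_neq0.
pose N k := ('C(n, k.*2) * 'C(k.*2, k) * 2 ^ (n - k.*2))%N.
transitivity (\sum_(0 <= k < n./2.+1)
    ((N k)%:R + (k * N k)%:R / d) / 2 ^+ n : R[i]).
  apply: eq_big_nat => k /andP[_ ltk]; rewrite gbinom_ratio // mul2n.
  have le2kn : (k.*2 <= n)%N by lia.
  have -> : 2 ^+ n = 2 ^+ (n - k.*2) * 2 ^+ k.*2 :> R[i].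
    by rewrite -exprD subnK.
  rewrite /N !natrM natrX.
  move: (2 ^+ k.*2) (2 ^+ (n - k.*2)) (t0 k.*2) (t0 (n - k.*2)%N).
  move=> u v u0 v0.
  by field; rewrite d0 u0 v0.
rewrite -mulr_suml big_split /= -mulr_suml -!natr_sum.
rewrite weighted_central_sum central_sum.
rewrite Gamma_sub_half Gamma_nat.
have s0 : (Num.sqrt (pi : R))%:C != 0 :> R[i].
  rewrite -(rmorph0 (real_complex R)) (inj_eq (@complexI R)).
  by rewrite sqrtr_eq0 -ltNge pi_gt0.
have f0 : n`!%:R != 0 :> R[i] by rewrite pnatr_eq0 -lt0n fact_gt0.
have h0 : n%:R * 2 - 1 != 0 :> R[i].
  by rewrite subr_eq0 -natrM pnatr_eq1; lia.
have -> : pochhammer (1 / 2) n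
  = n`!%:R * 'C(n.*2, n)%:R / 2 ^+ n / 2 ^+ n :> R[i].
  rewrite -pochhammer_half (_ : 4 = 2 * 2); last by rewrite -natrM.
  rewrite exprMn; move: (pochhammer _ _) => p.
  by field; exact: t0.
(* For n <= 1 both sides are 0. *)
have w : (n * (1 < n) * 'C(n.-1.*2, n.-2))%:R * 2 * (n%:R * 2 - 1)
   = n%:R * (n%:R - 1) * 'C(n.*2, n)%:R :> R[i].
  clear; case: n => [|[|n]]; rewrite ?mul0r ?subrr ?mulr0 ?mul0r //.
  have := congr1 (fun x => x%:R : R[i]) (mul_bin_central n).
  rewrite /= !natrM natrD natrM /= -(natr1 n) -[n.+2%:R]/((2 + n)%:R) natrD.
  move: ('C(_, n)%:R) ('C(_, n.+2)%:R) => a b ratio.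
  have -> : (2 + n%:R) * (2 + n%:R - 1) * b = (2 + n%:R) * ((n%:R + 1) * b).
    by ring.
  by rewrite -ratio; ring.
have {w} -> : (n * (1 < n) * 'C(n.-1.*2, n.-2))%:R
    = n%:R * (n%:R - 1) * 'C(n.*2, n)%:R / 2 / (n%:R * 2 - 1) :> R[i].
  by rewrite -w; field.
move: (2 ^+ n) (t0 n) => v v0.
by field; rewrite v0 d0 s0 f0 h0.
Qed.
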